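(* Let $a_1,\ldots,a_n\in\mathbb{D}$ and let $\mathbf{B}(\boldsymbol z)=\big(z_1\varphi_{a_1}(z_1),\ldots,z_n\varphi_{a_n}(z_n)\big)$ for $\boldsymbol z=(z_1,\ldots,z_n)\in\mathbb{D}^n$. For every $n$-tuple $\boldsymbol\lambda=(\lambda_1,\ldots,\lambda_n)$ of positive even integers and each $\boldsymbol k\in\widehat{{\rm Deck}(\mathbf{B})}\cong\mathbb{Z}_2^n$, $\mathbb{P}_{\boldsymbol k}\big(\mathbb{A}^{(\boldsymbol\lambda)}(\mathbb{D}^n)\big)$ is a (joint) reducing subspace of the multiplication operator tuple $\mathbf{M}_{\mathbf{B}}$ acting on $\mathbb{A}^{(\boldsymbol\lambda)}(\mathbb{D}^n)$.
   Context: $\mathbb{D}$ is the open unit disc. For $a\in\mathbb{D}$ and $|t|=1$, $\varphi_{t,a}(z)=t\frac{z-a}{1-\bar az}$ and $\varphi_a=\varphi_{1,a}$; $\varphi_{-1,a}$ is an involution of $\mathbb{D}$. $\mathbb{A}^{(\boldsymbol\lambda)}(\mathbb{D}^n)$ is the Hilbert space of holomorphic functions on $\mathbb{D}^n$ with reproducing kernel $\prod_{j=1}^n(1-z_j\bar w_j)^{-\lambda_j}$. With ${\rm B}_i(\boldsymbol z)=z_i\varphi_{a_i}(z_i)$, $\mathbf{M}_{\mathbf{B}}=(M_{{\rm B}_1},\ldots,M_{{\rm B}_n})$ is the tuple of multiplication operators. For $\boldsymbol\lambda$ a tuple of positive even integers and $\Phi=(\varphi_1,\ldots,\varphi_n)$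 with each $\varphi_i$ an automorphism of $\mathbb{D}$ acting on the $i$-th coordinate, put $$U^{(\boldsymbol\lambda)}(\Phi^{-1})f=\Big(\prod_{i=1}^n(\varphi_i'(z_i))^{\lambda_i/2}\Big)(f\circ\Phi);$$ this is a unitary representation of $\mathrm{Aut}(\mathbb{D})^n$ on $\mathbb{A}^{(\boldsymbol\lambda)}(\mathbb{D}^n)$. The deck group is ${\rm Deck}(\mathbf{B})=\prod_{i=1}^n\{\mathrm{id},\varphi_{-1,a_i}\}\cong\mathbb{Z}_2^n$; for $\boldsymbol j\in\mathbb{Z}_2^n$ let $\Psi_{\boldsymbol j}$ be the element whose $i$-th component is $\mathrm{id}$ if $j_i=0$ and $\varphi_{-1,a_i}$ if $j_i=1$. Its characters are $\chi_{\boldsymbol k}(\boldsymbol j)=e^{2\pi i(\boldsymbol j\cdot\boldsymbol k)/2}$, $\boldsymbol j\cdot\boldsymbol k=\sum_rj_rk_r$, $\boldsymbol k\in\mathbb{Z}_2^n$. Define $$\mathbb{P}_{\boldsymbol k}=\frac1{2^n}\sum_{\boldsymbol j\in\mathbb{Z}_2^n}\overline{\chi_{\boldsymbol k}(\boldsymbol j)}\,U^{(\boldsymbol\lambda)}(\Psi_{\boldsymbol j}^{-1}).$$ A joint reducing subspace of a tuple is a closed subspace invariant under every operator of the tuple and its adjoint. *)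

(* Defs.v *)
From HB Require Import structures.
From mathcomp Require Import all_boot all_order all_algebra complex ring.
From mathcomp Require Import all_classical all_reals all_analysis.

Set Implicit Arguments.
Unset Strict Implicit.
Unset Printing Implicit Defensive.

Import Order.TTheory GRing.Theory Num.Theory.
Import numFieldNormedType.Exports.

Local Open Scope classical_set_scope.
Local Open Scope ring_scope.

(* The alias [^o] is what gives the complex numbers their structure of normed
   module over themselves, so that [derive1] and [differentiable] below are the
   complex derivative and complex (Frechet) differentiability. *)
Notation Cx R := (complex R)^o.

Section PolydiscDefs.
Variables (R : realType) (n : nat).

Definition polydisc : set 'rV[Cx R]_n := [set z | forall i, `|z 0 i| < 1].

Definition coord (z : polydisc) (i : 'I_n) : Cx R := val z 0 i.

(* Differentiability at a point of the open set [polydisc] only depends on the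
   values of [F] on [polydisc], so the choice of the extension is irrelevant. *)
Definition holomorphic (f : polydisc -> Cx R) : Prop :=
  exists F : 'rV[Cx R]_n -> Cx R,
    (forall z : polydisc, f z = F (val z)) /\
    (forall z, polydisc z -> differentiable F z).

(* [insubd z] returns the junk value [z] when some [phi i] sends [coord z i]
   outside of the disc; see [polydisc_mapE]. *)
Definition polydisc_map (phi : 'I_n -> Cx R -> Cx R) (z : polydisc) : polydisc :=
  insubd z (\row_i phi i (coord z i)).

Lemma polydisc_mapE (phi : 'I_n -> Cx R -> Cx R) (z : polydisc) :
  (forall i (x : Cx R), `|x| < 1 -> `|phi i x| < 1) ->
  val (polydisc_map phi z) = \row_i phi i (coord z i).
Proof.
move=> phiD; rewrite insubdK//; apply/mem_set => i; rewrite mxE; apply: phiD.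
exact: (set_mem (valP z) i).
Qed.

End PolydiscDefs.
Arguments polydisc : clear implicits.

Section HilbertFunctionSpaces.
Variable R : realType.

(* A Hilbert space whose vectors are functions [T -> C].  The values of [hdot]
   outside of the carrier [hcarrier] are irrelevant.  The inner product is
   linear in its first argument. *)
Record hilbert_fun_space (T : Type) := HilbertFunSpace {
  hcarrier : set (T -> Cx R) ;
  hdot : (T -> Cx R) -> (T -> Cx R) -> R[i] ;
  hcarrier0 : hcarrier 0 ;
  hcarrier_linear : forall (c : R[i]) f g,
    hcarrier f -> hcarrier g -> hcarrier (c *: f + g) ;
  hdot_linear : forall (c : R[i]) f g h,
    hcarrier f -> hcarrier g -> hcarrier h ->
    hdot (c *: f + g) h = c * hdot f h + hdot g h ;
  hdot_conj : forall f g, hcarrier f -> hcarrier g -> hdot f g = (hdot g f)^* ;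
  hdot_gt0 : forall f, hcarrier f -> f <> 0 -> 0 < hdot f f ;
  hcomplete : forall u : nat -> T -> Cx R,
    (forall m, hcarrier (u m)) ->
    (forall e : R, 0 < e -> exists N : nat, forall p q : nat,
       (N <= p)%N -> (N <= q)%N ->
       Num.sqrt (complex.Re (hdot (u p - u q) (u p - u q))) < e) ->
    exists2 f, hcarrier f &
      Num.sqrt (complex.Re (hdot (u m - f) (u m - f))) @[m --> \oo] --> (0 : R) }.

Section Operators.
Variables (T : Type) (H : hilbert_fun_space T).
Implicit Types (S : set (T -> Cx R)) (A B : (T -> Cx R) -> T -> Cx R).

Definition hnorm (f : T -> Cx R) : R := Num.sqrt (complex.Re (hdot H f f)).

Definition reproducing_kernel (K : T -> T -> Cx R) : Prop :=
  forall w : T,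
    hcarrier H (K ^~ w) /\
    forall f, hcarrier H f -> hdot H f (K ^~ w) = f w.

Definition bounded_operator A : Prop :=
  [/\ forall f, hcarrier H f -> hcarrier H (A f),
      forall (c : R[i]) f g, hcarrier H f -> hcarrier H g ->
        A (c *: f + g) = c *: A f + A g &
      exists M : R, forall f, hcarrier H f -> hnorm (A f) <= M * hnorm f].

Definition is_adjoint A B : Prop :=
  bounded_operator B /\
  forall f g, hcarrier H f -> hcarrier H g -> hdot H (A f) g = hdot H f (B g).

Definition closed_subspace S : Prop :=
  [/\ S `<=` hcarrier H,
      S 0,
      forall (c : R[i]) f g, S f -> S g -> S (c *: f + g) &
      forall (u : nat -> T -> Cx R) f, (forall m, S (u m)) -> hcarrier H f ->
        hnorm (u m - f) @[m --> \oo] --> (0 : R) -> S f].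

(* The adjoint of a bounded operator on [H] exists and is unique on [H], so that
   [exists2 B] picks out the adjoint of [A i]. *)
Definition joint_reducing_subspace (n : nat)
    (A : 'I_n -> (T -> Cx R) -> T -> Cx R) S : Prop :=
  [/\ forall i, bounded_operator (A i),
      closed_subspace S,
      forall i f, S f -> S (A i f) &
      forall i, exists2 B, is_adjoint (A i) B & forall f, S f -> S (B f)].

End Operators.
End HilbertFunctionSpaces.

Section Moebius.
Variable R : realType.

Definition moebius (t a : R[i]) : Cx R -> Cx R :=
  fun z => t * ((z - a) / (1 - a^* * z)).

Lemma moebius_disc (t a z : R[i]) :
  `|t| = 1 -> `|a| < 1 -> `|z| < 1 -> `|moebius t a z| < 1.
Proof.
move=> t1 a1 z1; rewrite normrM t1 mul1r normrM normfV.
have az1 : `|a^* * z| < 1.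
  by rewrite normrM norm_conjC mulr_ilt1.
have d0 : 0 < `|1 - a^* * z|.
  by rewrite normr_gt0 subr_eq0; apply: contraTneq az1 => <-; rewrite normr1 ltxx.
rewrite ltr_pdivrMr// mul1r -(@ltr_pXn2r _ 2%N) ?nnegrE//.
rewrite !normCK !rmorphB rmorph1 rmorphM/= conjCK -subr_gt0.
have -> : (1 - a^* * z) * (1 - a * z^*) - (z - a) * (z^* - a^*) =
          (1 - `|a| ^+ 2) * (1 - `|z| ^+ 2).
  by rewrite !normCK; ring.
by rewrite mulr_gt0// subr_gt0 exprn_ilt1.
Qed.

End Moebius.

Section WeightedSpaces.
Variables (R : realType) (n : nat).
Implicit Types (a : 'I_n -> R[i]) (lambda : 'I_n -> nat).
Local Notation D := (polydisc R n).

Definition weighted_kernel lambda (z w : D) : Cx R :=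
  \prod_(j < n) (1 - coord z j * (coord w j)^*) ^- lambda j.

(* A reproducing kernel Hilbert space is determined by its kernel
   (Moore-Aronszajn), so this predicate characterizes the space, up to the
   irrelevant values of [hdot] outside of its carrier. *)
Definition is_weighted_space lambda (H : hilbert_fun_space R D) : Prop :=
  (forall f, hcarrier H f -> holomorphic f) /\
  reproducing_kernel H (weighted_kernel lambda).

Definition mult_op (psi f : D -> Cx R) : D -> Cx R := fun z => psi z * f z.

Definition blaschke a (i : 'I_n) (z : D) : Cx R :=
  coord z i * moebius 1 (a i) (coord z i).

(* This is U^(lambda)(Phi^-1), for Phi the map acting as [phi i] on the i-th
   coordinate. *)
Definition rep_inv lambda (phi : 'I_n -> Cx R -> Cx R) (f : D -> Cx R) :
    D -> Cx R :=
  fun z => (\prod_(i < n) (derive1 (phi i) (coord z i)) ^+ (lambda i)./2)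
           * f (polydisc_map phi z).

Definition deck a (j : {ffun 'I_n -> 'Z_2}) (i : 'I_n) : Cx R -> Cx R :=
  if j i == 0 then id else moebius (-1) (a i).

Definition cexpi (theta : R) : R[i] := Complex (cos theta) (sin theta).

Definition deck_char (k j : {ffun 'I_n -> 'Z_2}) : R[i] :=
  cexpi (2 * pi * (\sum_(r < n) (j r : nat) * (k r : nat))%N%:R / 2).

Definition deck_proj a lambda (k : {ffun 'I_n -> 'Z_2}) (f : D -> Cx R) :
    D -> Cx R :=
  (2 ^+ n : R[i])^-1 *:
  \sum_(j : {ffun 'I_n -> 'Z_2}) (deck_char k j)^* *: rep_inv lambda (deck a j) f.

End WeightedSpaces.

(* Main.v *)
Require Import Defs.
From HB Require Import structures.
From mathcomp Require Import all_boot all_order all_algebra complex.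
From mathcomp Require Import all_classical all_reals all_analysis.
From mathcomp Require Import ring lra.

Import Order.TTheory GRing.Theory Num.Theory.
Import numFieldNormedType.Exports.

Local Open Scope classical_set_scope.
Local Open Scope ring_scope.

(** A space of functions with a reproducing kernel is governed by its kernel:
    the finite sums [ksum s] of kernel functions are dense, pairing a function
    with such a sum evaluates it at finitely many points, and an operator given
    pointwise can be studied through its formal adjoint, which moves the points
    around.  Everything below follows from four facts.

    First, [bounded_pairing_carrier] is the Riesz representation theorem on the
    span of the kernel functions: a function [u] such that
    [sum_j conj(c_j) u(w_j)] is bounded by [M] times the norm of
    [sum_j c_j K_(w_j)] lies in the space and has norm at most [M].  The vector
    is found by minimising [|g|^2 - 2 Re <u, g>] over kernel sums [g].  It gives
    the existence of adjoints ([adjoint_exists]) and the membership test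
    [wcomp_bounded]: the weighted composition [f |-> h (f o Phi)] is
    bounded, with norm at most one, as soon as
    [K(z, w) - h(z) conj(h(w)) K(Phi z, Phi w)] is positive semidefinite.

    Second, multiplication by [B_i = z_i phi_(a_i)(z_i)] passes this test.
    Indeed [1 - B_i(z) conj(B_i(w))] is [1 - z_i conj(w_i)] times a positive
    kernel, and [(1 - z_i conj(w_i)) K] is the weighted kernel with [lambda_i]
    lowered by one, which is positive because [lambda_i > 0]
    ([blaschke_bounded]).  Positivity of the weighted kernels is an iterated
    geometric series ([psd_geometric]).

    Third, the deck group acts by bounded operators: evenness of [lambda] and the
    identity [(1 - phi(z) conj(phi(w)))^2 = phi'(z) conj(phi'(w)) (1 - z conj(w))^2]
    show that the kernel is invariant ([weighted_kernel_deck]).  As every deck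
    transformation is an involution, its operator is self-adjoint, and the
    chain rule makes [j |-> U_j] a representation of the group of exponents.  The
    characters are real, so the averages [P_k] are self-adjoint idempotents.

    Fourth, [B_i] is invariant under the deck group, so [P_k] commutes with the
    multiplication operators; a self-adjoint idempotent commuting with an
    operator also commutes with its adjoint, so its range reduces the operator
    ([projection_range_reducing]). *)

(** * Inner product and norm of a Hilbert space of functions *)

Section InnerProduct.
Context {R : realType} {T : Type} (H : hilbert_fun_space R T).
Implicit Types (f g h : T -> Cx R) (c : R[i]).
Local Notation hc := (hcarrier H).
Local Notation dot := (hdot H).
Local Notation norm := (hnorm H).

Lemma hcarrierD f g : hc f -> hc g -> hc (f + g).
Proof.
by move=> Hf Hg; rewrite -[f]scale1r; exact: (hcarrier_linear 1 Hf Hg).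
Qed.

Lemma hcarrierZ c f : hc f -> hc (c *: f).
Proof.
move=> Hf; rewrite -[c *: f]addr0.
exact: (hcarrier_linear c Hf (hcarrier0 H)).
Qed.

Lemma hcarrierB f g : hc f -> hc g -> hc (f - g).
Proof. by move=> Hf Hg; rewrite -scaleN1r; exact/hcarrierD/hcarrierZ. Qed.

Lemma hcarrier_sum I (r : seq I) (F : I -> T -> Cx R) :
  (forall i, hc (F i)) -> hc (\sum_(i <- r) F i).
Proof.
by move=> HF; elim/big_ind: _ => //; [exact: hcarrier0 | exact: hcarrierD].
Qed.

Lemma hdotDl f g h : hc f -> hc g -> hc h -> dot (f + g) h = dot f h + dot g h.
Proof.
by move=> Hf Hg Hh; rewrite -[f in LHS]scale1r (hdot_linear 1 Hf Hg Hh) mul1r.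
Qed.

Lemma hdot0l h : hc h -> dot 0 h = 0.
Proof.
move=> Hh; apply: (@addrI _ (dot 0 h)); rewrite -hdotDl ?addr0 //;
  exact: hcarrier0.
Qed.

Lemma hdotZl c f h : hc f -> hc h -> dot (c *: f) h = c * dot f h.
Proof.
move=> Hf Hh; rewrite -[c *: f]addr0.
by rewrite (hdot_linear c Hf (hcarrier0 H) Hh) hdot0l// addr0.
Qed.

Lemma hdotDr f g h : hc f -> hc g -> hc h -> dot f (g + h) = dot f g + dot f h.
Proof.
move=> Hf Hg Hh; rewrite (hdot_conj Hf Hg) (hdot_conj Hf Hh) -rmorphD -hdotDl//.
by apply: hdot_conj => //; exact: hcarrierD.
Qed.

Lemma hdotZr c f g : hc f -> hc g -> dot f (c *: g) = c^* * dot f g.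
Proof.
move=> Hf Hg; rewrite (hdot_conj Hf Hg) -rmorphM -hdotZl//.
by apply: hdot_conj => //; exact: hcarrierZ.
Qed.

Lemma hdot0r f : hc f -> dot f 0 = 0.
Proof.
by move=> Hf; rewrite hdot_conj ?hdot0l ?conjC0//; exact: hcarrier0.
Qed.

Lemma hdotBl f g h : hc f -> hc g -> hc h -> dot (f - g) h = dot f h - dot g h.
Proof.
move=> Hf Hg Hh; rewrite -scaleN1r hdotDl ?hdotZl ?mulN1r//; exact: hcarrierZ.
Qed.

Lemma hdotBr f g h : hc f -> hc g -> hc h -> dot f (g - h) = dot f g - dot f h.
Proof.
move=> Hf Hg Hh; rewrite -scaleN1r hdotDr ?hdotZr ?rmorphN1 ?mulN1r//.
exact: hcarrierZ.
Qed.

Lemma hdot_suml I (r : seq I) (F : I -> T -> Cx R) h :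
  (forall i, hc (F i)) -> hc h ->
  dot (\sum_(i <- r) F i) h = \sum_(i <- r) dot (F i) h.
Proof.
move=> HF Hh; elim: r => [|i r IH]; first by rewrite !big_nil hdot0l.
by rewrite !big_cons hdotDl ?IH//; exact: hcarrier_sum.
Qed.

Lemma hdot_sumr I (r : seq I) (F : I -> T -> Cx R) h :
  (forall i, hc (F i)) -> hc h ->
  dot h (\sum_(i <- r) F i) = \sum_(i <- r) dot h (F i).
Proof.
move=> HF Hh; elim: r => [|i r IH]; first by rewrite !big_nil hdot0r.
by rewrite !big_cons hdotDr ?IH//; exact: hcarrier_sum.
Qed.

Lemma hdot_ge0 f : hc f -> 0 <= dot f f.
Proof.
move=> Hf; have [->|/eqP fN0] := eqVneq f 0; first by rewrite hdot0l//; exact: hcarrier0.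
exact/ltW/hdot_gt0.
Qed.

(** Estimates are made on the real part, where inequalities are available; the
    complex identities are recovered at the end by [Re_eqi]. *)
Definition rdot f g : R := complex.Re (dot f g).

Lemma rdotC f g : hc f -> hc g -> rdot f g = rdot g f.
Proof. by move=> Hf Hg; rewrite /rdot hdot_conj//; case: (dot g f). Qed.

Lemma rdotDl f g h : hc f -> hc g -> hc h ->
  rdot (f + g) h = rdot f h + rdot g h.
Proof. by move=> *; rewrite /rdot hdotDl// raddfD. Qed.

Lemma rdotBl f g h : hc f -> hc g -> hc h ->
  rdot (f - g) h = rdot f h - rdot g h.
Proof. by move=> *; rewrite /rdot hdotBl// raddfB. Qed.

Lemma rdotBr f g h : hc f -> hc g -> hc h ->
  rdot f (g - h) = rdot f g - rdot f h.
Proof. by move=> *; rewrite /rdot hdotBr// raddfB. Qed.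

Lemma rdotDr f g h : hc f -> hc g -> hc h ->
  rdot f (g + h) = rdot f g + rdot f h.
Proof. by move=> *; rewrite /rdot hdotDr// raddfD. Qed.

Lemma rdotZl (x : R) f g : hc f -> hc g ->
  rdot (real_complex R x *: f) g = x * rdot f g.
Proof.
move=> Hf Hg; rewrite /rdot hdotZl//.
by case: (dot f g) => u v /=; rewrite mul0r subr0.
Qed.

Lemma rdotZr (x : R) f g : hc f -> hc g ->
  rdot f (real_complex R x *: g) = x * rdot f g.
Proof.
by move=> Hf Hg; rewrite rdotC ?rdotZl 1?rdotC//; exact: hcarrierZ.
Qed.

Lemma hnorm_sqr f : hc f -> norm f ^+ 2 = rdot f f.
Proof.
by move=> Hf; rewrite sqr_sqrtr//; move: (hdot_ge0 f Hf); rewrite lecE => /andP[].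
Qed.

Lemma hnorm_ge0 f : 0 <= norm f.
Proof. exact: sqrtr_ge0. Qed.

Lemma hnorm_eq0 f : hc f -> norm f = 0 -> f = 0.
Proof.
move=> Hf f0; apply: contrapT => /(hdot_gt0 Hf).
rewrite ltcE => /andP[_].
by rewrite -[X in _ < X]/(rdot f f) -hnorm_sqr// f0 expr0n ltxx.
Qed.

Lemma cauchy_schwarz f g : hc f -> hc g -> rdot f g <= norm f * norm g.
Proof.
move=> Hf Hg.
have [f0|fN0] := eqVneq (norm f) 0.
  by rewrite f0 mul0r (hnorm_eq0 _ Hf f0) /rdot hdot0l.
have [g0|gN0] := eqVneq (norm g) 0.
  by rewrite g0 mulr0 (hnorm_eq0 _ Hg g0) /rdot hdot0r.
have fg0 : 0 < norm f * norm g by rewrite mulr_gt0 ?lt_def ?fN0 ?gN0 ?hnorm_ge0.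
(* Expand the squared norm of [|g| f - |f| g]. *)
pose u := real_complex R (norm g) *: f; pose v := real_complex R (norm f) *: g.
have Hu : hc u by exact: hcarrierZ.
have Hv : hc v by exact: hcarrierZ.
have := sqr_ge0 (norm (u - v)); rewrite hnorm_sqr; last exact: hcarrierB.
rewrite rdotBl ?rdotBr//; last exact: hcarrierB.
rewrite (rdotC v u)// !rdotZl// !rdotZr// -!hnorm_sqr// => h.
rewrite -subr_ge0 -(pmulr_rge0 _ fg0); move: h fg0.
move: (norm f) (norm g) (rdot f g) => x y z h fg0.
have -> : x * y * (x * y - z) =
  2^-1 * (y * (y * x ^+ 2) - y * (x * z) - (y * (x * z) - x * (x * y ^+ 2))).
  by field.
by rewrite mulr_ge0// invr_ge0 ler0n.
Qed.

Lemma hnormN f : hc f -> norm (- f) = norm f.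
Proof.
move=> Hf; have Hf' := hcarrierZ (-1) _ Hf.
by rewrite /hnorm -scaleN1r hdotZl ?hdotZr// rmorphN1 mulrA mulrNN !mul1r.
Qed.

Lemma hnormD f g : hc f -> hc g -> norm (f + g) <= norm f + norm g.
Proof.
move=> Hf Hg; have Hfg := hcarrierD _ _ Hf Hg.
rewrite -(@ler_pXn2r _ 2) ?nnegrE ?addr_ge0 ?hnorm_ge0//.
have := cauchy_schwarz _ _ Hf Hg.
rewrite sqrrD !hnorm_sqr// rdotDl ?rdotDr// (rdotC g f)//.
by move: (norm f * norm g) (rdot _ _) (rdot _ _) (rdot _ _) => *; lra.
Qed.

(** Recovers a sesquilinear form from its real part, by replacing a vector [f]
    with ['i f]. *)
Lemma Re_eqi (x y : R[i]) : complex.Re x = complex.Re y ->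
  complex.Re (Complex 0 1 * x) = complex.Re (Complex 0 1 * y) -> x = y.
Proof.
case: x y => [a b] [c d] /= -> /eqP.
by rewrite !mul0r !mul1r !sub0r eqr_opp => /eqP ->.
Qed.

End InnerProduct.

Lemma ge0_cvg {R : realType} (a : nat -> R) (l : R) :
  (forall k, 0 <= a k) -> a k @[k --> \oo] --> l -> 0 <= l.
Proof.
move=> a0 al; rewrite -(cvg_lim _ al)//; apply: limr_ge; last exact: nearW.
by apply/cvg_ex; exists l.
Qed.

(** * Kernel sums and Riesz representation *)

Section KernelSums.
Context {R : realType} {T : Type} (H : hilbert_fun_space R T).
Variable K : T -> T -> Cx R.
Hypothesis KH : reproducing_kernel H K.
Implicit Types (u f g : T -> Cx R) (c : R[i]) (s t : seq (R[i] * T)).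
Local Notation hc := (hcarrier H).
Local Notation dot := (hdot H).
Local Notation norm := (hnorm H).

(** Formal combinations of points are kept as sequences, so that no choice of
    coefficients has to be made for a function in the span of the kernel
    functions. *)
Definition ksum s : T -> Cx R := \sum_(p <- s) p.1 *: K ^~ p.2.

(** For [u] in the space this is [<u, ksum s>], but it makes sense for every
    function [u]. *)
Definition pairing u s : R[i] := \sum_(p <- s) p.1^* * u p.2.

Definition sscale c s : seq (R[i] * T) := [seq (c * p.1, p.2) | p <- s].

Lemma kernel_carrier w : hc (K ^~ w). Proof. by have [] := KH w. Qed.

Lemma hdot_kernel f w : hc f -> dot f (K ^~ w) = f w.
Proof. by have [_] := KH w; apply. Qed.

Lemma ksum_carrier s : hc (ksum s).
Proof. by apply: hcarrier_sum => p; exact/hcarrierZ/kernel_carrier. Qed.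

Lemma ksum_cat s t : ksum (s ++ t) = ksum s + ksum t.
Proof. by rewrite /ksum big_cat. Qed.

Lemma ksum_scale c s : ksum (sscale c s) = c *: ksum s.
Proof.
by rewrite /ksum big_map scaler_sumr; apply: eq_bigr => p _; rewrite scalerA.
Qed.

Lemma pairing_cat u s t : pairing u (s ++ t) = pairing u s + pairing u t.
Proof. by rewrite /pairing big_cat. Qed.

Lemma pairing_scale u c s : pairing u (sscale c s) = c^* * pairing u s.
Proof.
rewrite /pairing big_map mulr_sumr; apply: eq_bigr => p _ /=.
by rewrite rmorphM mulrA.
Qed.

Lemma hdot_ksum f s : hc f -> dot f (ksum s) = pairing f s.
Proof.
move=> Hf; rewrite /ksum hdot_sumr//; last first.
  by move=> p; exact/hcarrierZ/kernel_carrier.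
apply: eq_bigr => p _; rewrite hdotZr ?hdot_kernel//; exact: kernel_carrier.
Qed.

Section Representation.
Variables (u : T -> Cx R) (M : R).
Hypothesis M0 : 0 <= M.
Hypothesis uM : forall s, complex.Re (pairing u s) <= M * norm (ksum s).

(** When [u] is in the space, [energy s] is [|ksum s - u|^2 - |u|^2], so that a
    minimising sequence converges to [u]. *)
Let energy s := norm (ksum s) ^+ 2 - 2 * complex.Re (pairing u s).

Let energyE s t : energy (s ++ t) = energy s + energy t +
  2 * rdot H (ksum s) (ksum t).
Proof.
have Hs := ksum_carrier s; have Ht := ksum_carrier t.
have Hst := hcarrierD H _ _ Hs Ht.
rewrite /energy ksum_cat pairing_cat !hnorm_sqr// raddfD/=.
rewrite rdotDl ?rdotDr// (rdotC _ (ksum t) (ksum s))//.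
by move: (rdot _ _ _) (rdot _ _ _) (rdot _ _ _) => x y z; ring.
Qed.

Let energy_half s : energy (sscale (real_complex R 2^-1) s) =
  4^-1 * norm (ksum s) ^+ 2 - complex.Re (pairing u s).
Proof.
have Hs := ksum_carrier s.
rewrite /energy ksum_scale pairing_scale !hnorm_sqr//; last exact: hcarrierZ.
rewrite rdotZl ?rdotZr//; last exact: hcarrierZ.
rewrite -[(real_complex R 2^-1)^*]/(conjc _) conjc_real.
case: (pairing u s) => x y /=; rewrite mul0r subr0.
by move: (rdot _ _ _) => z; field.
Qed.

Let energy_ge s : - M ^+ 2 <= energy s.
Proof.
have := uM s; rewrite /energy; move: (norm _) (complex.Re _) => x y h.
have : 0 <= (x - M) ^+ 2 by exact: sqr_ge0.
by rewrite sqrrB; lra.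
Qed.

Let m := inf [set energy s | s in [set: seq (R[i] * T)]].

Let energy_has_inf : has_inf [set energy s | s in [set: seq (R[i] * T)]].
Proof.
split; first by exists (energy [::]), [::].
by exists (- M ^+ 2) => _ [s _ <-]; exact: energy_ge.
Qed.

Let m_le s : m <= energy s.
Proof. by apply: ge_inf; [case: energy_has_inf | exists s]. Qed.

Let minimizing : exists s : nat -> seq (R[i] * T),
  forall k, energy (s k) < m + k.+1%:R^-1.
Proof.
have : forall k : nat, exists s, energy s < m + k.+1%:R^-1.
  move=> k; have [|_ [s _ <-] h] := @inf_adherent _ _ k.+1%:R^-1 _ energy_has_inf.
    by rewrite invr_gt0.
  by exists s.
by move=> /choice[s sP]; exists s.
Qed.

(** For a minimising sequence the parallelogram identity turns closeness of the
    energies to their infimum into closeness of the vectors. *)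
Let parallelogram s t :
  norm (ksum s - ksum t) ^+ 2 <= 2 * (energy s + energy t) - 4 * m.
Proof.
have Hs := ksum_carrier s; have Ht := ksum_carrier t.
have := m_le (sscale (real_complex R 2^-1) (s ++ t)).
rewrite energy_half ksum_cat pairing_cat raddfD/= /energy.
rewrite !hnorm_sqr//; [|exact: hcarrierB|exact: hcarrierD].
rewrite rdotBl ?rdotBr ?rdotDl ?rdotDr//; do ?[exact: hcarrierB|exact: hcarrierD].
rewrite (rdotC _ (ksum t) (ksum s))//.
by move: m (rdot _ _ _) (rdot _ _ _) (rdot _ _ _) => m' x y z; lra.
Qed.

(** The bound says that [u] defines a bounded conjugate-linear functional on the
    span of the kernel functions. *)
Lemma bounded_pairing_carrier :
  [/\ hc u, norm u <= M &
   exists s : nat -> seq (R[i] * T),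
     norm (ksum (s k) - u) @[k --> \oo] --> (0 : R)].
Proof.
have [s sP] := minimizing.
have sH k : hc (ksum (s k)) by exact: ksum_carrier.
have cauchy (e : R) : 0 < e -> exists N : nat, forall p q : nat,
    (N <= p)%N -> (N <= q)%N -> norm (ksum (s p) - ksum (s q)) < e.
  move=> e0.
  have e2 : 0 < e ^+ 2 / 4 by rewrite divr_gt0// exprn_gt0.
  have [N _ NP] := near_infty_natSinv_lt (PosNum e2).
  exists N => p q Np Nq; rewrite -(@ltr_pXn2r _ 2) ?nnegrE ?hnorm_ge0 ?(ltW e0)//.
  apply: le_lt_trans (parallelogram (s p) (s q)) _.
  have := NP p Np; have := NP q Nq; have := sP p; have := sP q => /=.
  by move: (p.+1%:R^-1) (q.+1%:R^-1) (energy _) (energy _) => x y z t; lra.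
(* The limit [f] of the minimising sequence is [u]: minimality along the
   direction of the kernel function at [w] forces [f w = u w]. *)
have [f Hf fP] := @hcomplete _ _ H (ksum \o s) sH cauchy.
have fu : f = u.
  apply/funext => w.
  have var c : 0 <= norm (c *: K ^~ w) ^+ 2 + 2 * complex.Re (c^* * (f w - u w)).
    have Hc : hc (c *: K ^~ w) by exact/hcarrierZ/kernel_carrier.
    have ck : ksum [:: (c, w)] = c *: K ^~ w by rewrite /ksum big_seq1.
    have bnd k : 0 <= norm (c *: K ^~ w) ^+ 2 + 2 * complex.Re (c^* * (f w - u w))
        + k.+1%:R^-1 + 2 * (norm (ksum (s k) - f) * norm (c *: K ^~ w)).
      have := m_le (s k ++ [:: (c, w)]); rewrite energyE.
      have := cauchy_schwarz H _ _ (hcarrierB H _ _ (sH k) Hf) Hc.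
      rewrite rdotBl//; have := sP k.
      have -> : complex.Re (c^* * (f w - u w)) =
          rdot H f (c *: K ^~ w) - complex.Re (pairing u [:: (c, w)]).
        rewrite /pairing big_seq1/= -raddfB/= /rdot hdotZr//.
          by rewrite hdot_kernel// mulrBr.
        exact: kernel_carrier.
      rewrite [energy [:: _]]/energy ck.
      move: (k.+1%:R^-1) (energy _) (norm _) (norm _) (rdot _ _ _) (rdot _ _ _).
      move: (complex.Re _).
      by move=> *; lra.
    move: bnd; set A := (X in 0 <= X).
    set N := norm _ => bnd.
    have lim : A + k.+1%:R^-1 + 2 * (norm (ksum (s k) - f) * N)
        @[k --> \oo] --> A + 0 + 2 * (0 * N).
      apply: cvgD; first by apply: cvgD; [exact: cvg_cst | exact: cvg_harmonic].
      by apply: cvgM; [exact: cvg_cst | apply: cvgM => //; exact: cvg_cst].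
    by have := ge0_cvg _ _ bnd lim; rewrite mul0r mulr0 !addr0.
  pose d := f w - u w; pose x := complex.Re (d^* * d).
  pose t := (rdot H (K ^~ w) (K ^~ w) + 1)^-1.
  have kk0 : 0 <= rdot H (K ^~ w) (K ^~ w).
    by rewrite -hnorm_sqr ?sqr_ge0//; exact: kernel_carrier.
  (* The choice [c = - t d] with [t] small makes the linear term dominate. *)
  have /= := var (real_complex R (- t) * d); rewrite -scalerA hnorm_sqr//; last first.
    by do 2!apply: hcarrierZ; exact: kernel_carrier.
  have Kw := kernel_carrier w; have dK := hcarrierZ H d _ Kw.
  rewrite rdotZl ?rdotZr//; last exact: hcarrierZ.
  have -> : rdot H (d *: K ^~ w) (d *: K ^~ w) = x * rdot H (K ^~ w) (K ^~ w).
    rewrite {1}/rdot hdotZl// hdotZr// mulrA (mulrC d) /x.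
    have /complex_realP[r ->] : d^* * d \is Num.real by rewrite mulrC -normCK realX.
    by rewrite /rdot; case: (dot _ _) => p q /=; rewrite mul0r subr0.
  have -> : complex.Re ((real_complex R (- t) * d)^* * d) = - t * x.
    have -> : (real_complex R (- t) * d)^* = real_complex R (- t) * d^*.
      by rewrite rmorphM; congr (_ * _); exact: conjc_real.
    rewrite -mulrA /x.
    by case: (d^* * d) => p q /=; rewrite mul0r subr0.
  have x0 : x = complex.Re d ^+ 2 + complex.Im d ^+ 2.
    by rewrite /x mulrC -normCK -add_Re2_Im2.
  have t0 : 0 < t by rewrite invr_gt0 ltr_wpDl.
  have tK : t * (rdot H (K ^~ w) (K ^~ w) + 1) = 1.
    by rewrite mulVf// gt_eqF// ltr_wpDl.
  move: kk0 tK; move: (rdot _ _ _) => q q0 tq h.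
  have {}h : 0 <= t * (x * (t * q - 2)).
    by apply: le_trans h _; rewrite le_eqVlt; apply/orP; left; apply/eqP; ring.
  have {}h : 0 <= x * (- 1 - t).
    by move: h; rewrite pmulr_rge0// (_ : t * q - 2 = - 1 - t)//; lra.
  have /eqP : x = 0.
    apply/eqP; rewrite eq_le; apply/andP; split.
      by rewrite leNgt; apply/negP => xp; move: h; rewrite pmulr_rge0//; lra.
    by rewrite x0 addr_ge0 ?sqr_ge0.
  rewrite x0 paddr_eq0 ?sqr_ge0// !sqrf_eq0 => /andP[/eqP d1 /eqP d2].
  by apply/eqP; rewrite -subr_eq0 -/d; apply/eqP; case: (d) d1 d2 => ? ? /= -> ->.
subst f; split=> //.
- (* Since [|u|^2 = <u, u - g> + <u, g>] is at most [|u| |u - g| + M |g|] for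
     every kernel sum [g], let [g] tend to [u]. *)
  have u0 := hnorm_ge0 H u.
  have bnd k : 0 <= M * norm u - norm u ^+ 2
      + (norm u + M) * norm (ksum (s k) - u).
    have Hg := sH k; have Hgu := hcarrierB H _ _ Hg Hf.
    have h1 := cauchy_schwarz H _ _ Hf (hcarrierB H _ _ Hf Hg).
    have h2 : rdot H u (ksum (s k)) <= M * norm (ksum (s k)).
      by rewrite /rdot hdot_ksum.
    have h3 := ler_wpM2l M0 (hnormD H _ _ Hgu Hf).
    move: h1 h2 h3; rewrite subrK rdotBr// -(hnormN H (u - _)) ?opprB//; last first.
      exact: hcarrierB.
    rewrite hnorm_sqr//.
    by move: (norm _) (norm _) (norm _) (rdot _ _ _) (rdot _ _ _) => *; lra.
  have lim : M * norm u - norm u ^+ 2 + (norm u + M) * norm (ksum (s k) - u)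
      @[k --> \oo] --> M * norm u - norm u ^+ 2 + (norm u + M) * 0.
    by apply: cvgD; [exact: cvg_cst | apply: cvgM => //; exact: cvg_cst].
  have := ge0_cvg _ _ bnd lim; rewrite mulr0 addr0 expr2 -mulrBl => h.
  have [->//|uN0] := eqVneq (norm u) 0.
  by rewrite -subr_ge0 -(pmulr_lge0 _ (_ : 0 < norm u))// lt_def uN0.
- by exists s.
Qed.

End Representation.
End KernelSums.

(** * Adjoints and reducing subspaces *)

Section Operators.
Context {R : realType} {T : Type} (H : hilbert_fun_space R T).
Implicit Types (f g : T -> Cx R) (c : R[i]) (A B : (T -> Cx R) -> T -> Cx R).
Local Notation hc := (hcarrier H).
Local Notation dot := (hdot H).
Local Notation norm := (hnorm H).

Lemma bounded_operator0 A : bounded_operator H A -> A 0 = 0.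
Proof.
case=> _ linA _; have h0 := hcarrier0 H.
by have := linA (-1) 0 0 h0 h0; rewrite scaler0 addr0 scaleN1r addNr.
Qed.

Lemma bounded_operatorZ A c f : bounded_operator H A -> hc f -> A (c *: f) = c *: A f.
Proof.
move=> bA Hf; have A0 := bounded_operator0 A bA; case: bA => _ linA _.
by have := linA c f 0 Hf (hcarrier0 H); rewrite !addr0 A0 addr0.
Qed.

Lemma bounded_operatorB A f g :
  bounded_operator H A -> hc f -> hc g -> A (f - g) = A f - A g.
Proof.
move=> bA Hf Hg; case: (bA) => _ linA _.
have := linA 1 f (- g) Hf _; rewrite !scale1r => ->; last first.
  by rewrite -scaleN1r; exact: hcarrierZ.
by rewrite -scaleN1r bounded_operatorZ// scaleN1r.
Qed.

Section Kernel.
Variable K : T -> T -> Cx R.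
Hypothesis KH : reproducing_kernel H K.
Local Notation ksum := (ksum K).

Lemma bounded_operator_ksum A s : bounded_operator H A ->
  A (ksum s) = \sum_(p <- s) p.1 *: A (K ^~ p.2).
Proof.
move=> bA; rewrite /ksum; elim: s => [|p s IH].
  by rewrite !big_nil bounded_operator0.
have Hs := ksum_carrier H K KH s.
case: (bA) => _ linA _; rewrite !big_cons linA ?IH//.
exact: (kernel_carrier H K KH).
Qed.

Lemma hdot_operator_ksum A f s : bounded_operator H A -> hc f ->
  dot f (A (ksum s)) = pairing (fun w => dot f (A (K ^~ w))) s.
Proof.
move=> bA Hf; rewrite bounded_operator_ksum//.
have AK w : hc (A (K ^~ w)).
  by case: bA => + _ _; apply; exact: (kernel_carrier H K KH).
rewrite hdot_sumr//; last by move=> p; exact: hcarrierZ.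
by apply: eq_bigr => p _; rewrite hdotZr.
Qed.

(** A vector [f] of the space satisfies the boundedness hypothesis of
    [bounded_pairing_carrier] by Cauchy-Schwarz, and the minimising sequence
    built there then converges to [f]. *)
Lemma ksum_dense f : hc f ->
  exists s : nat -> seq (R[i] * T),
    norm (ksum (s k) - f) @[k --> \oo] --> (0 : R).
Proof.
move=> Hf; have [|s|_ _ //] := bounded_pairing_carrier H K KH f (norm f).
- exact: hnorm_ge0.
- rewrite -(hdot_ksum H K KH)//; apply: cauchy_schwarz => //.
  exact: (ksum_carrier H K KH).
Qed.

(** An adjunction needs to be tested on kernel functions only: both sides are
    continuous in [g], and kernel sums are dense. *)
Lemma adjoint_on_kernel A B : bounded_operator H A -> bounded_operator H B ->
  (forall f w, hc f -> B f w = dot f (A (K ^~ w))) ->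
  forall f g, hc f -> hc g -> dot (B f) g = dot f (A g).
Proof.
move=> bA bB BA.
have [HA _ [M AM]] := bA; have [HB _ _] := bB.
have re_le f g : hc f -> hc g -> rdot H (B f) g <= rdot H f (A g).
  move=> Hf Hg; have [s sg] := ksum_dense g Hg.
  have Hs k := ksum_carrier H K KH (s k).
  have HBf := HB f Hf; have HAg := HA g Hg; have HAs k := HA _ (Hs k).
  have bnd k : 0 <= rdot H f (A g) - rdot H (B f) g
      + (norm (B f) + norm f * M) * norm (ksum (s k) - g).
    have Hd := hcarrierB H _ _ (Hs k) Hg.
    have h1 := cauchy_schwarz H _ _ Hf (HA _ Hd).
    have h2 := cauchy_schwarz H _ _ HBf (hcarrierB H _ _ Hg (Hs k)).
    have h3 := ler_wpM2l (hnorm_ge0 H f) (AM _ Hd).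
    have h4 : rdot H (B f) (ksum (s k)) = rdot H f (A (ksum (s k))).
      rewrite /rdot hdot_operator_ksum// (hdot_ksum H K KH)//; congr complex.Re.
      by apply: eq_bigr => p _; rewrite BA.
    move: h1 h2 h3 h4; rewrite -(hnormN H (g - _)) ?opprB//; last exact: hcarrierB.
    rewrite bounded_operatorB// !rdotBr//.
    move: (norm _) (norm _) (norm _) (norm _) => x y z t.
    by move: (rdot _ _ _) (rdot _ _ _) (rdot _ _ _) (rdot _ _ _) => *; lra.
  have lim : rdot H f (A g) - rdot H (B f) g
      + (norm (B f) + norm f * M) * norm (ksum (s k) - g)
      @[k --> \oo] --> rdot H f (A g) - rdot H (B f) g
      + (norm (B f) + norm f * M) * 0.
    by apply: cvgD; [exact: cvg_cst | apply: cvgM => //; exact: cvg_cst].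
  by have := ge0_cvg _ _ bnd lim; rewrite mulr0 addr0 subr_ge0.
have re_eq f g : hc f -> hc g -> rdot H (B f) g = rdot H f (A g).
  move=> Hf Hg; apply/eqP; rewrite eq_le re_le//=.
  have HBf := HB f Hf; have HAg := HA g Hg.
  have := re_le (-1 *: f) g (hcarrierZ H _ _ Hf) Hg.
  rewrite bounded_operatorZ// /rdot !hdotZl// !mulN1r !raddfN/=.
  by rewrite lerN2.
move=> f g Hf Hg; have HBf := HB f Hf; have HAg := HA g Hg.
apply: Re_eqi; first exact: re_eq.
rewrite -!hdotZl// -bounded_operatorZ//; apply: re_eq => //; exact: hcarrierZ.
Qed.

(** The value at [w] of an adjoint [B] must be [<B f, K_w> = <f, A K_w>].  Taking
    this as a definition, boundedness of [A] is exactly what puts [B f] in the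
    space. *)
Lemma adjoint_exists A : bounded_operator H A -> exists B, is_adjoint H A B.
Proof.
move=> bA; have [HA linA [M AM]] := bA.
have HK w := kernel_carrier H K KH w.
pose B f w : Cx R := dot f (A (K ^~ w)).
have Bbnd f : hc f -> hc (B f) /\ norm (B f) <= `|M| * norm f.
  move=> Hf; have [|s|] := bounded_pairing_carrier H K KH (B f) (`|M| * norm f).
  - by rewrite mulr_ge0// hnorm_ge0.
  - have Hs := ksum_carrier H K KH s; rewrite -hdot_operator_ksum//.
    apply: le_trans (cauchy_schwarz H _ _ Hf (HA _ Hs)) _.
    rewrite (mulrC `|M|) -mulrA; apply: ler_wpM2l; first exact: hnorm_ge0.
    apply: le_trans (AM _ Hs) _; apply: ler_wpM2r; first exact: hnorm_ge0.
    exact: ler_norm.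
  - by split.
have bB : bounded_operator H B.
  split; first by move=> f /Bbnd[].
    move=> c f g Hf Hg; apply/funext => w; rewrite /B.
    have HAw := HA _ (HK w); have Hcf := hcarrierZ H c _ Hf.
    by rewrite hdotDl// hdotZl.
  by exists `|M| => f /Bbnd[].
exists B; split=> // f g Hf Hg.
have HBg := (Bbnd g Hg).1.
rewrite (hdot_conj Hf HBg) (adjoint_on_kernel A B bA bB)//.
by rewrite -hdot_conj//; exact: HA.
Qed.

End Kernel.

(** The range of [P] is its set of fixed vectors, which is closed because the
    equation [P f = f] can be tested weakly, [<f, P g> = <f, g>] for all [g].
    Taking adjoints in [A P = P A] shows that [P] commutes with the adjoint of
    [A], so that both operators preserve the range. *)
Lemma projection_range_reducing (n : nat)
    (A : 'I_n -> (T -> Cx R) -> T -> Cx R) (P : (T -> Cx R) -> T -> Cx R) :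
  (forall i, bounded_operator H (A i)) ->
  (forall i, exists B, is_adjoint H (A i) B) ->
  (forall f, hc f -> hc (P f)) ->
  (forall c f g, P (c *: f + g) = c *: P f + P g) ->
  (forall f, P (P f) = P f) ->
  (forall f g, hc f -> hc g -> dot (P f) g = dot f (P g)) ->
  (forall i f, A i (P f) = P (A i f)) ->
  joint_reducing_subspace H A [set P f | f in hc].
Proof.
move=> bA adjA HP linP idP saP comm.
have HA i f : hc f -> hc (A i f) by case: (bA i) => + _ _; apply.
have nondeg f g : hc f -> hc g ->
    (forall h, hc h -> dot f h = dot g h) -> f = g.
  move=> Hf Hg fg; have Hd := hcarrierB H _ _ Hf Hg.
  apply/eqP; rewrite -subr_eq0; apply/eqP; apply: (hnorm_eq0 H) => //.
  by rewrite /hnorm hdotBl// fg// subrr sqrtr0.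
have P0 : P 0 = 0.
  by have := linP (-1) 0 0; rewrite scaler0 addr0 scaleN1r addNr.
have fixedP f : hc f -> P f = f -> [set P f | f in hc] f by move=> Hf <-; exists f.
split=> //.
- split.
  + by move=> _ [f Hf <-]; exact: HP.
  + by apply: fixedP => //; exact: hcarrier0.
  + move=> c _ _ [f Hf <-] [g Hg <-]; exists (c *: f + g) => //.
    exact: hcarrier_linear.
  + move=> u f Su Hf uf; apply: fixedP => //.
    have HPf := HP f Hf; apply: nondeg => // h Hh.
    have Hu m : hc (u m) by have [g Hg <-] := Su m; exact: HP.
    have Pu m : P (u m) = u m by have [g Hg <-] := Su m; exact: idP.
    (* The weak equation holds for each [u m] and passes to the limit. *)
    have re_le g : hc g -> rdot H f (P g) <= rdot H f g.
      move=> Hg; have HPg := HP g Hg.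
      have bnd m : 0 <= rdot H f g - rdot H f (P g)
          + (norm g + norm (P g)) * norm (u m - f).
        have Hd := hcarrierB H _ _ (Hu m) Hf.
        have Hd' := hcarrierB H _ _ Hf (Hu m).
        have h1 := cauchy_schwarz H _ _ Hd Hg.
        have h2 := cauchy_schwarz H _ _ Hd' HPg.
        have h3 : rdot H (u m) (P g) = rdot H (u m) g by rewrite /rdot -saP// Pu.
        move: h1 h2 h3; rewrite -(hnormN H (f - _)) ?opprB// !rdotBl//.
        move: (norm _) (norm _) (norm _) => x y z.
        by move: (rdot _ _ _) (rdot _ _ _) (rdot _ _ _) (rdot _ _ _) => *; lra.
      have lim : rdot H f g - rdot H f (P g) + (norm g + norm (P g)) * norm (u m - f)
          @[m --> \oo] --> rdot H f g - rdot H f (P g) + (norm g + norm (P g)) * 0.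
        by apply: cvgD; [exact: cvg_cst | apply: cvgM => //; exact: cvg_cst].
      by have := ge0_cvg _ _ bnd lim; rewrite mulr0 addr0 subr_ge0.
    have PZ c g : P (c *: g) = c *: P g by have := linP c g 0; rewrite !addr0 P0 addr0.
    have re_eq g : hc g -> rdot H f (P g) = rdot H f g.
      move=> Hg; have HPg := HP g Hg; apply/eqP; rewrite eq_le re_le//=.
      have := re_le (-1 *: g) (hcarrierZ H _ _ Hg).
      by rewrite PZ /rdot !hdotZr// !rmorphN1 !mulN1r !raddfN/= lerN2.
    rewrite saP//; apply: Re_eqi; first exact: re_eq.
    have HPh := HP h Hh.
    have i2 : Complex 0 1 = (Complex 0 (-1))^* :> R[i].
      by rewrite -[RHS]/(conjc _) /= opprK.
    rewrite i2 -!hdotZr// -PZ; apply: re_eq; exact: hcarrierZ.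
- by move=> i _ [f Hf <-]; exists (A i f) => //; exact: HA.
- move=> i; have [B adjB] := adjA i; exists B => // _ [f Hf <-].
  case: adjB => -[HB _ _] adjB; have HPf := HP f Hf.
  apply: fixedP; first exact: HB.
  have HBPf := HB _ HPf; apply: nondeg => // [|h Hh]; first exact: HP.
  have HPh := HP h Hh; have HAh := HA i h Hh.
  have adjC g : hc g -> dot (B (P f)) g = dot (P f) (A i g).
    move=> Hg; have HAg := HA i g Hg.
    by rewrite (hdot_conj HBPf Hg) -adjB// -hdot_conj.
  by rewrite saP// adjC// comm -saP// idP adjC.
Qed.

End Operators.

(** * Positive kernels and weighted composition operators *)

Section PositiveKernels.
Context {R : realType} {T : Type}.
Implicit Types (P : T -> T -> Cx R) (h c : T -> Cx R) (Phi : T -> T).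
Implicit Types (s : seq (R[i] * T)).

Definition quad P s : R[i] :=
  \sum_(q <- s) \sum_(p <- s) q.1^* * (p.1 * P q.2 p.2).

(** For a Hermitian kernel the form [quad P s] is real, and this is the usual
    positive semidefiniteness. *)
Definition psd P := forall s, 0 <= complex.Re (quad P s).

(** The action on points of the formal adjoint of [f |-> h (f o Phi)], which maps
    the kernel function at [w] to [conj(h w)] times the one at [Phi w]. *)
Definition spush h Phi s : seq (R[i] * T) :=
  [seq ((h p.2)^* * p.1, Phi p.2) | p <- s].

Definition wcomp h Phi (f : T -> Cx R) : T -> Cx R := fun z => h z * f (Phi z).

Lemma pairing_wcomp h Phi f s : pairing (wcomp h Phi f) s = pairing f (spush h Phi s).
Proof.
rewrite /pairing big_map; apply: eq_bigr => p _ /=.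
have -> : ((h p.2)^* * p.1)^* = h p.2 * p.1^* :> R[i] by rewrite rmorphM/= conjCK.
by rewrite mulrCA mulrA.
Qed.

Lemma quad_spush P h Phi s :
  quad P (spush h Phi s) =
  quad (fun z w => h z * (h w)^* * P (Phi z) (Phi w)) s.
Proof.
rewrite /quad big_map; apply: eq_bigr => q _; rewrite big_map.
apply: eq_bigr => p _ /=.
have -> : ((h q.2)^* * q.1)^* = h q.2 * q.1^* :> R[i] by rewrite rmorphM/= conjCK.
move: (h q.2) (h p.2)^* (P _ _) (q.1^*) (p.1) => x y z t u.
change (x * t * (y * u * z) = t * (u * (x * y * z)) :> R[i]); ring.
Qed.

Lemma quadD P Q s : quad (fun z w => P z w + Q z w) s = quad P s + quad Q s.
Proof.
rewrite /quad -big_split; apply: eq_bigr => q _; rewrite -big_split.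
apply: eq_bigr => p _; move: (P _ _) (Q _ _) (q.1^*) (p.1) => x y t u.
change (t * (u * (x + y)) = t * (u * x) + t * (u * y) :> R[i]); ring.
Qed.

Lemma quadZ (x : R[i]) P s : quad (fun z w => x * P z w) s = x * quad P s.
Proof.
rewrite /quad mulr_sumr; apply: eq_bigr => q _; rewrite mulr_sumr.
apply: eq_bigr => p _; move: (P _ _) (q.1^*) (p.1) => y t u.
change (t * (u * (x * y)) = x * (t * (u * y)) :> R[i]); ring.
Qed.

Lemma psd_spush P h Phi :
  psd P -> psd (fun z w => h z * (h w)^* * P (Phi z) (Phi w)).
Proof. by move=> psdP s; rewrite -quad_spush; exact: psdP. Qed.

Lemma psdD P Q : psd P -> psd Q -> psd (fun z w => P z w + Q z w).
Proof. by move=> psdP psdQ s; rewrite quadD raddfD/= addr_ge0. Qed.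

Lemma psdZ (x : R[i]) P : 0 <= x -> psd P -> psd (fun z w => x * P z w).
Proof.
move=> x0 psdP s; rewrite quadZ -(RRe_real (ger0_real x0)).
have := psdP s; case: (quad P s) => u v /= u0; rewrite mul0r subr0 mulr_ge0//.
by move: x0; rewrite lecE => /andP[].
Qed.

Lemma psd1 : psd (fun _ _ => 1).
Proof.
move=> s; have -> : quad (fun _ _ => 1) s = `|\sum_(p <- s) p.1| ^+ 2.
  rewrite normCK mulrC rmorph_sum /quad mulr_suml; apply: eq_bigr => q _.
  rewrite mulr_sumr; apply: eq_bigr => p _.
  by congr (_ * _); exact: mulr1.
have : 0 <= `|\sum_(p <- s) p.1| ^+ 2 by exact: exprn_ge0.
by rewrite lecE => /andP[].
Qed.

Lemma cvg_Re_geometric (k x : R[i]) : `|x| < 1 ->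
  complex.Re (k * x ^+ N) @[N --> \oo] --> (0 : R).
Proof.
move=> x1; have r1 : `|complex.Re `|x| | < 1.
  have /complex_realP[r xr] : `|x| \is Num.real by exact: normr_real.
  rewrite xr /=; move: x1 (normr_ge0 x); rewrite xr ltcR ler0c => r1 r0.
  by rewrite ger0_norm.
have lim := @cvg_geometric R (complex.Re `|k|) (complex.Re `|x|) r1.
have lim' : - geometric (complex.Re `|k|) (complex.Re `|x|) N @[N --> \oo] --> (0 : R).
  by rewrite -oppr0; exact: cvgN.
apply: (squeeze_cvgr _ lim' lim); apply: nearW => N.
rewrite -ler_norml /geometric/= -lecR; apply: le_trans (normc_ge_Re _) _.
have -> : real_complex R (complex.Re `|k| * complex.Re `|x| ^+ N) =
    real_complex R (complex.Re `|k|) * real_complex R (complex.Re `|x|) ^+ N.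
  by rewrite rmorphM rmorphXn.
by rewrite !RRe_real ?normr_real// normrM normrX.
Qed.

(** Iterating [P = (1 - c conj(c)) P + c conj(c) P] writes [P] as a sum of
    positive kernels plus the remainder [c^N conj(c)^N P], which tends to zero;
    this is the geometric series of [1 / (1 - c conj(c))]. *)
Lemma psd_geometric P c : (forall z, `|c z| < 1) ->
  psd (fun z w => (1 - c z * (c w)^*) * P z w) -> psd P.
Proof.
move=> c1 psdP s.
pose Q N := quad P (spush (fun z => c z ^+ N) id s).
have Qle N : complex.Re (Q N) <= complex.Re (quad P s).
  have Q0 : Q 0%N = quad P s.
    rewrite /Q quad_spush; apply: eq_bigr => q _; apply: eq_bigr => p _ /=.
    by rewrite !expr0 conjC1 !mul1r.
  elim: N => [|N IH]; first by rewrite Q0.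
  apply: le_trans IH; rewrite -subr_ge0 -raddfB/=.
  have -> : Q N - Q N.+1 = quad (fun z w => (1 - c z * (c w)^*) * P z w)
      (spush (fun z => c z ^+ N) id s).
    apply: (@addIr _ (Q N.+1)); rewrite subrK /Q !quad_spush -quadD.
    apply: eq_bigr => q _; apply: eq_bigr => p _ /=.
    congr (_ * (_ * _)); rewrite !rmorphXn/= !exprS.
    move: (c q.2) (c p.2)^* (P _ _) => x y z.
    change (x ^+ N * y ^+ N * z = x ^+ N * y ^+ N * ((1 - x * y) * z) + 
      x * x ^+ N * (y * y ^+ N) * z :> R[i]).
    by move: (x ^+ N) (y ^+ N) => x' y'; ring.
  exact: psdP.
have lim : complex.Re (Q N) @[N --> \oo] --> (0 : R).
  rewrite /Q /quad.
  have -> : (fun N => complex.Re (quad P (spush (fun z => c z ^+ N) id s))) =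
    (fun N => \sum_(q <- s) \sum_(p <- s) complex.Re
      (q.1^* * p.1 * P q.2 p.2 * (c q.2 * (c p.2)^*) ^+ N)).
    apply/funext => N; rewrite quad_spush /quad raddf_sum; apply: eq_bigr => q _ /=.
    rewrite raddf_sum; apply: eq_bigr => p _ /=; congr complex.Re.
    rewrite rmorphXn/= exprMn.
    move: (c q.2 ^+ N) ((c p.2)^* ^+ N) (P _ _) (q.1^*) (p.1) => x y z t u.
    change (t * (u * (x * y * z)) = t * u * z * (x * y) :> R[i]); ring.
  have sum0 (a : R[i] * T -> nat -> R) r : (forall q, a q N @[N --> \oo] --> (0 : R)) ->
      \sum_(q <- r) a q N @[N --> \oo] --> (0 : R).
    move=> a0; elim: r => [|q r IH].
      by under eq_fun do rewrite big_nil; exact: cvg_cst.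
    under eq_fun do rewrite big_cons.
    have : a q N + \sum_(p <- r) a p N @[N --> \oo] --> (0 : R) + 0 by exact: cvgD.
    by rewrite addr0.
  apply: (sum0) => q; apply: (sum0) => p; apply: cvg_Re_geometric.
  by rewrite normrM norm_conjC mulr_ilt1.
have lim' : complex.Re (quad P s) - complex.Re (Q N) @[N --> \oo] -->
    complex.Re (quad P s) - 0 by apply: cvgB => //; exact: cvg_cst.
by rewrite -[X in 0 <= X]subr0; apply: ge0_cvg lim' => N; rewrite subr_ge0.
Qed.

Lemma psd_div_geometric P c m : (forall z, `|c z| < 1) -> psd P ->
  psd (fun z w => P z w * (1 - c z * (c w)^*) ^- m).
Proof.
move=> c1 psdP.
have c0 z w : 1 - c z * (c w)^* != 0 :> R[i].
  have cc1 : `|c z * (c w)^* : R[i]| < 1 by rewrite normrM norm_conjC mulr_ilt1.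
  by rewrite subr_eq0; apply: contraTneq cc1 => <-; rewrite normr1 ltxx.
elim: m => [|m IH].
  move=> s; suff -> : quad (fun z w => P z w * (1 - c z * (c w)^*) ^- 0) s = quad P s.
    exact: psdP.
  apply: eq_bigr => q _; apply: eq_bigr => p _; congr (_ * (_ * _)).
  by rewrite expr0 invr1 mulr1.
apply: (psd_geometric _ c c1) => s.
have -> : quad (fun z w => (1 - c z * (c w)^*) * (P z w * (1 - c z * (c w)^*) ^- m.+1)) s
   = quad (fun z w => P z w * (1 - c z * (c w)^*) ^- m) s.
  apply: eq_bigr => q _; apply: eq_bigr => p _; congr (_ * (_ * _)).
  rewrite mulrCA exprS invfM; congr (_ * _).
  exact: mulVKf.
exact: IH.
Qed.

Section WeightedComposition.
Variables (H : hilbert_fun_space R T) (K : T -> T -> Cx R).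
Hypothesis KH : reproducing_kernel H K.

Lemma hnorm_ksum s : hnorm H (ksum K s) ^+ 2 = complex.Re (quad K s).
Proof.
have Hs := ksum_carrier H K KH s.
rewrite hnorm_sqr// /rdot (hdot_ksum H K KH)//; congr complex.Re.
apply: eq_bigr => q _; rewrite /ksum fct_sumE mulr_sumr.
by apply: eq_bigr => p _.
Qed.

(** The hypothesis says that the formal adjoint does not increase the norms of
    kernel sums; by duality neither does the composition operator itself. *)
Lemma wcomp_bounded h Phi :
  psd (fun z w => K z w - h z * (h w)^* * K (Phi z) (Phi w)) ->
  bounded_operator H (wcomp h Phi).
Proof.
move=> psdK.
have key f : hcarrier H f ->
    hcarrier H (wcomp h Phi f) /\ hnorm H (wcomp h Phi f) <= hnorm H f.
  move=> Hf; have [|s|] := bounded_pairing_carrier H K KH (wcomp h Phi f) (hnorm H f).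
  - exact: hnorm_ge0.
  - have Hs := ksum_carrier H K KH (spush h Phi s).
    rewrite pairing_wcomp -(hdot_ksum H K KH)//.
    apply: le_trans (cauchy_schwarz H _ _ Hf Hs) _.
    apply: ler_wpM2l; first exact: hnorm_ge0.
    rewrite -(@ler_pXn2r _ 2) ?nnegrE ?hnorm_ge0// !hnorm_ksum quad_spush.
    rewrite -subr_ge0 -raddfB/=.
    have -> : quad K s - quad (fun z w => h z * (h w)^* * K (Phi z) (Phi w)) s =
        quad (fun z w => K z w - h z * (h w)^* * K (Phi z) (Phi w)) s.
      by apply/eqP; rewrite subr_eq -quadD; apply/eqP; apply: eq_bigr => q _;
         apply: eq_bigr => p _; rewrite subrK.
    exact: psdK.
  - by split.
split; first by move=> f /key[].
- move=> c f g _ _; apply/funext => z.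
  change (h z * (c * f (Phi z) + g (Phi z)) =
    c * (h z * f (Phi z)) + h z * g (Phi z) :> R[i]).
  by rewrite mulrDr mulrCA.
- by exists 1 => f /key[]; rewrite mul1r.
Qed.

End WeightedComposition.
End PositiveKernels.

(** * Moebius transformations of the disc *)

Lemma derive1_linear_fractional (F : numFieldType) (t a b z : F) :
  1 - b * z != 0 ->
  derive1 (fun x : F => t * ((x - a) / (1 - b * x))) z =
  t * (1 - a * b) / (1 - b * z) ^+ 2.
Proof.
move=> d0.
have dx : is_derive z 1 (fun x : F => x - a) 1.
  by apply: is_derive_eq; rewrite subr0.
have dd : is_derive z 1 (fun x : F => 1 - b * x) (- b).
  apply: is_derive_eq; rewrite sub0r; congr (- _).
  exact: mulr1.
have di : is_derive z 1 (fun x : F => (1 - b * x)^-1) ((1 - b * z) ^- 2 * b).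
  apply: DeriveDef; first by apply: derivableV => //; case: dd.
  rewrite deriveV//.
  by rewrite (@derive_val _ _ _ _ _ _ _ dd) scalerN scaleNr opprK.
have dm := is_deriveM dx di.
rewrite derive1E.
have -> : 'D_1 (fun x : F => t * ((x - a) / (1 - b * x))) z =
    t * 'D_1 ((fun x : F => x - a) * (fun x : F => (1 - b * x)^-1)) z.
  by rewrite -deriveMl//.
rewrite (@derive_val _ _ _ _ _ _ _ dm).
rewrite [_ *: (_ * b)]mulrC [_ *: 1]mulr1; field.
exact: d0.
Qed.

Section Disc.
Variable R : realType.
Implicit Types (x y z w a : R[i]).

Lemma moebius_denominator a z : `|a| < 1 -> `|z| < 1 -> 1 - a^* * z != 0.
Proof.
move=> a1 z1; have az1 : `|a^* * z| < 1 by rewrite normrM norm_conjC mulr_ilt1.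
by rewrite subr_eq0; apply: contraTneq az1 => <-; rewrite normr1 ltxx.
Qed.

(** The transformation law of the Szego kernel, on which both the boundedness
    of multiplication by a Blaschke factor and the invariance of the weighted
    kernels rest. *)
Lemma moebius_kernel t a z w : `|t| = 1 -> `|a| < 1 -> `|z| < 1 -> `|w| < 1 ->
  1 - moebius t a z * (moebius t a w)^* =
  (1 - `|a| ^+ 2) * (1 - z * w^*) / ((1 - a^* * z) * (1 - a^* * w)^*).
Proof.
move=> t1 a1 z1 w1; have d1 := moebius_denominator a z a1 z1.
have d2 := moebius_denominator a w a1 w1.
have d3 : (1 - a^* * w)^* != 0 by rewrite conjC_eq0.
have tt : t * t^* = 1 by rewrite -normCK t1 expr1n.
have -> : (moebius t a w)^* = t^* * ((w - a)^* / (1 - a^* * w)^*).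
  by rewrite /moebius !rmorphM fmorphV.
have -> : moebius t a z * (t^* * ((w - a)^* / (1 - a^* * w)^*)) =
    (z - a) * (w - a)^* / ((1 - a^* * z) * (1 - a^* * w)^*).
  rewrite /moebius [_^-1 in RHS]invfM -[RHS]mul1r -tt.
  move: ((1 - a^* * z)^-1) => u; move: (((1 - a^* * w)^*)^-1) => v.
  by move: (w - a)^* => e; ring.
rewrite normCK.
have dd : (1 - a^* * z) * (1 - a^* * w)^* != 0 by rewrite mulf_neq0.
apply: (mulIf dd); rewrite mulrBl mul1r !divfK//.
rewrite !rmorphB rmorph1 rmorphM/= conjCK.
by move: (a^*) (w^*) => b v; ring.
Qed.

Lemma moebius_involutive a z : `|a| < 1 -> `|z| < 1 ->
  moebius (-1) a (moebius (-1) a z) = z.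
Proof.
move=> a1 z1; have d1 := moebius_denominator a z a1 z1.
have d2 : 1 - a^* * moebius (-1) a z != 0.
  by apply: moebius_denominator => //; apply: moebius_disc; rewrite ?normrN1.
have num : moebius (-1) a z - a = - z * (1 - a^* * moebius (-1) a z).
  by move: d1; rewrite /moebius; move: (a^*) => b d1; field.
by rewrite {1}/moebius num mulfK// mulN1r opprK.
Qed.

Lemma moebiusN1 a z : moebius (-1) a z = - moebius 1 a z.
Proof. by rewrite /moebius mul1r mulN1r. Qed.

Lemma derive1_moebius a z : `|a| < 1 -> `|z| < 1 ->
  derive1 (moebius (-1) a) z = - (1 - `|a| ^+ 2) / (1 - a^* * z) ^+ 2.
Proof.
move=> a1 z1; have d1 := moebius_denominator a z a1 z1.
have := derive1_linear_fractional _ (-1) a a^* z d1.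
by rewrite mulN1r -normCK; apply: etrans.
Qed.

End Disc.

(** * The deck group and the weighted kernels *)

Section Deck.
Variables (R : realType) (n : nat) (a : 'I_n -> R[i]).
Hypothesis a1 : forall i, `|a i| < 1.
Implicit Types (j l k : {ffun 'I_n -> 'Z_2}) (i : 'I_n) (x y : R[i]).
Local Notation D := (polydisc R n).

Lemma Z2_cases (u : 'Z_2) : u = 0 \/ u = 1.
Proof. by case: u => [[|[|]]]//= ?; [left | right]; exact: val_inj. Qed.

Lemma deck_disc j i x : `|x| < 1 -> `|deck a j i x| < 1.
Proof.
move=> x1; rewrite /deck; case: ifP => // _.
by apply: moebius_disc; rewrite ?normrN1.
Qed.

Lemma deck_comp j l i x : `|x| < 1 ->
  deck a l i (deck a j i x) = deck a (j + l) i x.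
Proof.
move=> x1; rewrite /deck ffunE.
have [->|->] := Z2_cases (j i); have [->|->] := Z2_cases (l i) => //=.
exact: moebius_involutive.
Qed.

Lemma derive1_deck j i x : `|x| < 1 ->
  derive1 (deck a j i) x =
  if j i == 0 then 1 else - (1 - `|a i| ^+ 2) / (1 - (a i)^* * x) ^+ 2.
Proof.
move=> x1; rewrite /deck; case: ifP => _; last exact: derive1_moebius.
by rewrite derive1E derive_id.
Qed.

(** The chain rule for the composition law [deck_comp]; in the only nontrivial
    case it says that the derivatives of an involution at [x] and at the image
    of [x] are inverse to each other. *)
Lemma derive1_deck_comp j l i x : `|x| < 1 ->
  derive1 (deck a j i) x * derive1 (deck a l i) (deck a j i x) =
  derive1 (deck a (j + l) i) x.
Proof.
move=> x1; have dx1 := deck_disc j i x x1.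
rewrite !derive1_deck// ffunE.
have d0 := moebius_denominator _ (a i) x (a1 i) x1.
have [jE|jE] := Z2_cases (j i); have [lE|lE] := Z2_cases (l i);
  rewrite jE lE /= ?addr0 ?mul1r ?mulr1 /deck ?jE//=.
have aN1 : 1 - `|a i| ^+ 2 != 0.
  by rewrite gt_eqF// subr_gt0 exprn_ilt1.
have -> : 1 - (a i)^* * moebius (-1) (a i) x =
    (1 - `|a i| ^+ 2) / (1 - (a i)^* * x).
  rewrite normCK /moebius; move: (a i)^* (a i) d0 => b c d0.
  by field.
move: aN1 d0; move: (1 - `|a i| ^+ 2) (1 - _) => u v u0 v0.
by field; rewrite u0 v0.
Qed.

Lemma deck_kernel j i x y : `|x| < 1 -> `|y| < 1 ->
  derive1 (deck a j i) x * (derive1 (deck a j i) y)^* * (1 - x * y^*) ^+ 2 =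
  (1 - deck a j i x * (deck a j i y)^*) ^+ 2.
Proof.
move=> x1 y1; rewrite !derive1_deck// /deck; case: ifP => _.
  by rewrite conjC1 !mul1r.
rewrite moebius_kernel ?normrN1//.
have d1 := moebius_denominator _ (a i) x (a1 i) x1.
have d2 := moebius_denominator _ (a i) y (a1 i) y1.
have d3 : (1 - (a i)^* * y)^* != 0 by rewrite conjC_eq0.
have -> : (- (1 - `|a i| ^+ 2) / (1 - (a i)^* * y) ^+ 2)^* =
    - (1 - `|a i| ^+ 2) / ((1 - (a i)^* * y)^*) ^+ 2.
  rewrite rmorphM fmorphV rmorphXn; congr (_ / _).
  by rewrite rmorphN rmorphB rmorph1 rmorphXn; congr (- (_ - _ ^+ _)); exact: conj_normC.
move: d1 d3; move: (1 - (a i)^* * y)^* (1 - (a i)^* * x) (y^*) (`|a i|) => u v w r d1 d3.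
by field; rewrite d1 d3.
Qed.

(** With [sigma = - phi], the involution [sigma] exchanges the two factors of
    [x * phi x = - (x * sigma x)]. *)
Lemma blaschke_deck j i x : `|x| < 1 ->
  deck a j i x * moebius 1 (a i) (deck a j i x) = x * moebius 1 (a i) x.
Proof.
move=> x1; rewrite /deck; case: ifP => // _.
move: (moebius_involutive _ (a i) x (a1 i) x1); rewrite {1}moebiusN1 => e.
by rewrite -[moebius 1 _ (moebius _ _ _)]opprK e moebiusN1 mulrN mulNr opprK mulrC.
Qed.

Local Notation coord := Defs.coord.
Local Notation Phi j := (polydisc_map (deck a j)).

Lemma coord_lt1 (z : D) i : `|coord z i| < 1.
Proof. exact: (set_mem (valP z) i). Qed.

Lemma coord_deck j (z : D) i : coord (Phi j z) i = deck a j i (coord z i).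
Proof.
rewrite /coord polydisc_mapE ?mxE// => {}i x; exact: deck_disc.
Qed.

Lemma coord_inj (z w : D) : (forall i, coord z i = coord w i) -> z = w.
Proof. by move=> zw; apply/val_inj/rowP => i; exact: zw. Qed.

Lemma polydisc_deck_comp j l z : Phi l (Phi j z) = Phi (j + l) z.
Proof.
apply: coord_inj => i; rewrite !coord_deck deck_comp//; exact: coord_lt1.
Qed.

Lemma deck_ffun_double j : j + j = 0.
Proof.
apply/ffunP => i; rewrite !ffunE.
by have [->|->] := Z2_cases (j i); exact: val_inj.
Qed.

Lemma polydisc_deck0 z : Phi 0 z = z.
Proof. by apply: coord_inj => i; rewrite coord_deck /deck ffunE. Qed.

Definition deck_jacobian (lambda : 'I_n -> nat) j (z : D) : Cx R :=
  \prod_(i < n) derive1 (deck a j i) (coord z i) ^+ (lambda i)./2.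

Lemma rep_inv_deckE lambda j :
  rep_inv lambda (deck a j) = wcomp (deck_jacobian lambda j) (Phi j).
Proof. by []. Qed.

Lemma deck_jacobian_comp lambda j l z :
  deck_jacobian lambda j z * deck_jacobian lambda l (Phi j z) =
  deck_jacobian lambda (j + l) z.
Proof.
rewrite /deck_jacobian -big_split; apply: eq_bigr => i _ /=.
rewrite coord_deck -derive1_deck_comp ?exprMn//; exact: coord_lt1.
Qed.

Lemma deck_jacobian0 lambda z : deck_jacobian lambda 0 z = 1.
Proof.
rewrite /deck_jacobian big1// => i _.
by rewrite derive1_deck ?coord_lt1// ffunE expr1n.
Qed.

Lemma kernel_denominator x y : `|x| < 1 -> `|y| < 1 -> 1 - x * y^* != 0.
Proof.
move=> x1 y1; have xy1 : `|x * y^*| < 1 by rewrite normrM norm_conjC mulr_ilt1.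
by rewrite subr_eq0; apply: contraTneq xy1 => <-; rewrite normr1 ltxx.
Qed.

(** Evenness of [lambda] allows [deck_kernel] to be raised to the power
    [lambda i / 2] in each variable. *)
Lemma weighted_kernel_deck lambda j (z w : D) : (forall i, ~~ odd (lambda i)) ->
  deck_jacobian lambda j z * (deck_jacobian lambda j w)^* *
    weighted_kernel lambda (Phi j z) (Phi j w) = weighted_kernel lambda z w.
Proof.
move=> even; rewrite /deck_jacobian /weighted_kernel rmorph_prod -!big_split.
apply: eq_bigr => i _ /=; rewrite !coord_deck rmorphXn/= -exprMn.
have lE : lambda i = (2 * (lambda i)./2)%N.
  by rewrite mul2n -[LHS]odd_double_half (negbTE (even i)).
have z1 := coord_lt1 z i; have w1 := coord_lt1 w i.
rewrite lE mul2n doubleK -mul2n.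
have dk := deck_kernel j i _ _ z1 w1.
have E0 := kernel_denominator _ _ (deck_disc j i _ z1) (deck_disc j i _ w1).
have d0 : derive1 (deck a j i) (coord z i) *
    (derive1 (deck a j i) (coord w i))^* != 0 :> R[i].
  by apply: contraTneq (expf_neq0 2 E0) => d0; rewrite -dk d0 mul0r eqxx.
rewrite !exprM -dk [X in _ / X]exprMn invfM; apply: mulVKf.
exact: expf_neq0.
Qed.

Lemma psd_weighted_kernel lambda : psd (weighted_kernel (R := R) (n := n) lambda).
Proof.
have key (r : seq 'I_n) :
    psd (fun z w : D => \prod_(i <- r) (1 - coord z i * (coord w i)^*) ^- lambda i).
  elim: r => [|i r IH].
    move=> s; have := @psd1 R D s; congr (0 <= complex.Re _).
    by apply: eq_bigr => q _; apply: eq_bigr => p _; rewrite big_nil.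
  move=> s; have := psd_div_geometric _ (fun z => coord z i) (lambda i)
    (fun z => coord_lt1 z i) IH s.
  congr (0 <= complex.Re _); apply: eq_bigr => q _; apply: eq_bigr => p _.
  by congr (_ * (_ * _)); rewrite big_cons mulrC.
exact: key.
Qed.

(** With [c = 1 - |a|^2], [x], [y] for the [i]-th coordinates of [z], [w], and
    [h(z) = x / (1 - conj(a) x)], the transformation law of the Szego kernel
    gives [1 - B(z) conj(B(w)) = (1 - x conj(y)) (1 + c h(z) conj(h(w)))], and the
    factor [1 - x conj(y)] lowers [lambda i] by one. *)
Lemma blaschke_bounded (A : hilbert_fun_space R D) lambda i :
  reproducing_kernel A (weighted_kernel lambda) -> (0 < lambda i)%N ->
  bounded_operator A (mult_op (blaschke a i)).
Proof.
move=> KA l0; apply: (wcomp_bounded A _ KA (blaschke a i) id).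
pose mu m := if m == i then (lambda i).-1 else lambda m.
pose c := 1 - `|a i| ^+ 2 : R[i].
have c0 : 0 <= c by rewrite subr_ge0 exprn_ile1// ltW.
pose h (z : D) : Cx R := coord z i / (1 - (a i)^* * coord z i).
move=> s; have := psdD _ _ (psd_weighted_kernel mu)
  (psdZ c _ c0 (psd_spush _ h id (psd_weighted_kernel mu))) s.
congr (0 <= complex.Re _); apply: eq_bigr => q _; apply: eq_bigr => p _.
congr (_ * (_ * _)); move: (q.2) (p.2) => z w.
have -> : weighted_kernel mu z w =
    (1 - coord z i * (coord w i)^*) * weighted_kernel lambda z w.
  rewrite /weighted_kernel (bigD1 i)//= [in RHS](bigD1 i)//= mulrA; congr (_ * _).
    rewrite /mu eqxx -{2}(prednK l0) exprS invfM; symmetry.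
    by apply: mulVKf; apply: kernel_denominator; exact: coord_lt1.
  by apply: eq_bigr => m /negbTE mi; rewrite /mu mi.
have z1 := coord_lt1 z i; have w1 := coord_lt1 w i.
have mk := moebius_kernel _ 1 (a i) _ _ (normr1 _) (a1 i) z1 w1.
have -> : (h w)^* = (coord w i)^* / (1 - (a i)^* * coord w i)^*.
  by rewrite /h rmorphM fmorphV.
have -> : (blaschke a i w)^* = (coord w i)^* * (moebius 1 (a i) (coord w i))^*.
  by rewrite /blaschke rmorphM.
rewrite /h /blaschke; move: mk; rewrite -/c [X in _ / X]mulrC invfM.
move: (moebius _ _ _) (moebius _ _ _)^* => m m'.
move: ((1 - (a i)^* * coord z i)^-1) (((1 - (a i)^* * coord w i)^*)^-1) => u v.
move: (weighted_kernel _ _ _) (coord z i) (coord w i)^* => K x y mk.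
change ((1 - x * y) * K + c * (x * u * (y * v) * ((1 - x * y) * K)) =
  K - x * m * (y * m') * K :> R[i]).
have -> : x * m * (y * m') = x * y * (1 - (1 - m * m')) by ring.
rewrite mk; ring.
Qed.

End Deck.

(** * Characters and the projections *)

Section Characters.
Variables (R : realType) (n : nat).
Implicit Types j l k : {ffun 'I_n -> 'Z_2}.

Lemma cexpi_pi_nat m : cexpi (pi * m%:R) = (-1) ^+ m :> R[i].
Proof.
suff [c s] : cos (pi * m%:R) = (-1) ^+ m :> R /\ sin (pi * m%:R) = 0 :> R.
  by rewrite /cexpi c s -[LHS]/(real_complex R _) rmorphXn rmorphN1.
elim: m => [|m [IHc IHs]]; first by rewrite mulr0 cos0 sin0 expr0.
by rewrite -natr1 mulrDr mulr1 cosDpi sinDpi IHc IHs oppr0 exprS mulN1r.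
Qed.

Lemma deck_charE k j :
  deck_char R k j = \prod_(r < n) (-1) ^+ ((j r : nat) * (k r : nat)).
Proof.
rewrite prodrXr /deck_char -cexpi_pi_nat; congr cexpi.
suff half (x : R) : 2 * pi * x / 2 = pi * x by exact: half.
by field.
Qed.

Lemma deck_char_real k j : (deck_char R k j)^* = deck_char R k j.
Proof.
rewrite deck_charE rmorph_prod; apply: eq_bigr => r _.
by rewrite rmorphXn rmorphN1.
Qed.

Lemma deck_charM k j l : deck_char R k j * deck_char R k l = deck_char R k (j + l).
Proof.
rewrite !deck_charE -big_split; apply: eq_bigr => r _ /=; rewrite ffunE.
have [->|->] := Z2_cases (j r); have [->|->] := Z2_cases (l r);
  rewrite /= ?mul0n ?mul1n ?expr0 ?mulr1 ?mul1r//.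
by rewrite -exprMn mulrNN mulr1 expr1n.
Qed.

End Characters.

Section DeckProjection.
Variables (R : realType) (n : nat) (a : 'I_n -> R[i]) (lambda : 'I_n -> nat).
Hypothesis a1 : forall i, `|a i| < 1.
Hypothesis even_lambda : forall i, ~~ odd (lambda i).
Variable A : hilbert_fun_space R (polydisc R n).
Hypothesis KA : reproducing_kernel A (weighted_kernel lambda).
Implicit Types (j l k : {ffun 'I_n -> 'Z_2}) (f g : polydisc R n -> Cx R).
Local Notation U j := (rep_inv lambda (deck a j)).
Local Notation P k := (deck_proj a lambda k).

Lemma rep_inv_bounded j : bounded_operator A (U j).
Proof.
rewrite rep_inv_deckE; apply: (wcomp_bounded A _ KA) => s.
have -> : quad (fun z w => weighted_kernel lambda z w
    - deck_jacobian R n a lambda j z * (deck_jacobian R n a lambda j w)^*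
      * weighted_kernel lambda (polydisc_map (deck a j) z)
                               (polydisc_map (deck a j) w)) s = 0.
  apply: big1 => q _; apply: big1 => p _.
  rewrite weighted_kernel_deck// subrr.
  by transitivity (q.1^* * (p.1 * 0) : R[i]) => //; rewrite !mulr0.
exact: lexx.
Qed.

Lemma rep_inv_comp j l f : U j (U l f) = U (j + l) f.
Proof.
apply/funext => z; rewrite !rep_inv_deckE /wcomp.
rewrite -polydisc_deck_comp// -deck_jacobian_comp//.
by rewrite mulrA.
Qed.

(** On a kernel function, invariance of the kernel gives
    [U_j K_w = conj(J(w)) K_(Phi w)], because [Phi] is an involution and
    [J(w) J(Phi w) = 1]; pairing [f] with it gives [J(w) f(Phi w) = (U_j f)(w)]. *)
Lemma rep_inv_selfadjoint j f g : hcarrier A f -> hcarrier A g ->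
  hdot A (U j f) g = hdot A f (U j g).
Proof.
have bU := rep_inv_bounded j.
apply: (adjoint_on_kernel A _ KA _ _ bU bU) => {}f w Hf.
set J := deck_jacobian R n a lambda j; set Phi := polydisc_map (deck a j).
have JJ : J w * J (Phi w) = 1.
  by rewrite deck_jacobian_comp// deck_ffun_double deck_jacobian0.
have -> : U j (weighted_kernel lambda ^~ w) =
    (J w)^* *: (weighted_kernel lambda ^~ (Phi w)).
  apply/funext => z; rewrite rep_inv_deckE /wcomp -/J -/Phi.
  have PP : Phi (Phi w) = w.
    by rewrite /Phi polydisc_deck_comp// deck_ffun_double polydisc_deck0.
  rewrite -[RHS]/((J w)^* * weighted_kernel lambda z (Phi w)).
  rewrite -(weighted_kernel_deck _ _ _ a1 lambda j z (Phi w))// -/J -/Phi PP.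
  have JJ' : (J w)^* * (J (Phi w))^* = 1 by rewrite -rmorphM JJ rmorph1.
  have cancel (x y y' u : R[i]) : y * y' = 1 -> x * u = y * (x * y' * u).
    by move=> yy; rewrite mulrA mulrCA yy mulr1.
  exact: cancel.
rewrite hdotZr//; last exact: (kernel_carrier A _ KA).
rewrite (hdot_kernel A _ KA)// -[LHS]/(J w * f (Phi w)).
by congr (_ * _); rewrite [RHS]conjCK.
Qed.

Lemma deck_projE k f z : P k f z =
  (2 ^+ n)^-1 * \sum_(j : {ffun 'I_n -> 'Z_2}) deck_char R k j * U j f z.
Proof.
rewrite /deck_proj; congr (_ * _); rewrite fct_sumE.
by apply: eq_bigr => j _; rewrite deck_char_real.
Qed.

Lemma deck_proj_carrier k f : hcarrier A f -> hcarrier A (P k f).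
Proof.
move=> Hf; apply: hcarrierZ; apply: hcarrier_sum => j; apply: hcarrierZ.
by case: (rep_inv_bounded j) => + _ _; apply.
Qed.

Lemma deck_proj_linear k c f g : P k (c *: f + g) = c *: P k f + P k g.
Proof.
apply/funext => z.
rewrite -[RHS]/(c * P k f z + P k g z) !deck_projE mulrCA -mulrDr; congr (_ * _).
rewrite mulr_sumr -big_split; apply: eq_bigr => j _ /=.
rewrite !rep_inv_deckE /wcomp -[(c *: f + g) _]/(c * f _ + g _).
move: (deck_char _ _ _) (deck_jacobian _ _ _ _ _ _) (f _) (g _) => x y u v.
change (x * (y * (c * u + v)) = c * (x * (y * u)) + x * (y * v) :> R[i]); ring.
Qed.

(** Each [chi(j) U_j] fixes the sum of all [chi(l) U_l], by translation in the
    group. *)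
Lemma deck_proj_idempotent k f : P k (P k f) = P k f.
Proof.
apply/funext => z; rewrite deck_projE [RHS]deck_projE; congr (_ * _).
have -> : \sum_j deck_char R k j * U j (P k f) z =
    \sum_(j : {ffun 'I_n -> 'Z_2}) (2 ^+ n)^-1 * \sum_(l : {ffun 'I_n -> 'Z_2})
       deck_char R k l * U l f z.
  apply: eq_bigr => j _.
  rewrite [in RHS](reindex_inj (addrI j)) rep_inv_deckE /wcomp deck_projE.
  have -> : \sum_l deck_char R k (j + l) * U (j + l) f z =
      deck_char R k j * (deck_jacobian R n a lambda j z *
        \sum_l deck_char R k l * U l f (polydisc_map (deck a j) z)).
    rewrite !mulr_sumr; apply: eq_bigr => l _.
    rewrite -deck_charM -rep_inv_comp.
    have swap (x y u v : R[i]) : x * u * (v * y) = x * (v * (u * y)).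
      by rewrite mulrACA -mulrA.
    exact: swap.
  have pull (x y c u : R[i]) : x * (y * (c * u)) = c * (x * (y * u)).
    by rewrite [y * (c * u)]mulrCA [LHS]mulrCA.
  exact: pull.
rewrite sumr_const card_ffun !card_ord -[LHS]mulr_natl natrX mulrA divff ?mul1r//.
Qed.

Lemma deck_proj_selfadjoint k f g : hcarrier A f -> hcarrier A g ->
  hdot A (P k f) g = hdot A f (P k g).
Proof.
move=> Hf Hg.
have HU j h : hcarrier A h -> hcarrier A (U j h).
  by case: (rep_inv_bounded j) => + _ _; apply.
have HcU j h : hcarrier A h -> hcarrier A ((deck_char R k j)^* *: U j h).
  by move=> Hh; exact/hcarrierZ/HU.
rewrite /deck_proj hdotZl ?hdotZr//; try by apply: hcarrier_sum => j; exact: HcU.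
rewrite hdot_suml ?hdot_sumr//; try by move=> j; exact: HcU.
congr (_ * _).
  by rewrite [RHS]fmorphV rmorphXn; congr (_ ^-1); congr (_ ^+ _);
     rewrite [RHS]rmorph_nat.
apply: eq_bigr => j _.
by rewrite hdotZl ?hdotZr// ?rep_inv_selfadjoint ?deck_char_real//; exact: HU.
Qed.

Lemma mult_blaschke_deck_proj k i f :
  mult_op (blaschke a i) (P k f) = P k (mult_op (blaschke a i) f).
Proof.
apply/funext => z; rewrite /mult_op !deck_projE mulrCA; congr (_ * _).
rewrite mulr_sumr; apply: eq_bigr => j _; rewrite mulrCA; congr (_ * _).
rewrite rep_inv_deckE /wcomp mulrCA; congr (_ * (_ * _)).
rewrite /blaschke coord_deck// blaschke_deck//; exact: coord_lt1.
Qed.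

End DeckProjection.

Theorem theorem7p11 (R : realType) (n : nat) (a : 'I_n -> R[i])
    (a_in_disc : forall i, `|a i| < 1)
    (lambda : 'I_n -> nat)
    (lambda_even : forall i, (0 < lambda i)%N /\ ~~ odd (lambda i))
    (A : hilbert_fun_space R (polydisc R n))
    (A_weighted : is_weighted_space lambda A)
    (k : {ffun 'I_n -> 'Z_2}) :
  joint_reducing_subspace A (fun i : 'I_n => mult_op (blaschke a i))
    [set deck_proj a lambda k f | f in hcarrier A].
Proof.
have [_ KA] := A_weighted.
have even i : ~~ odd (lambda i) by have [] := lambda_even i.
have bM i : bounded_operator A (mult_op (blaschke a i)).
  by apply: (blaschke_bounded _ _ _ a_in_disc _ lambda _ KA); have [] := lambda_even i.
apply: projection_range_reducing.
- exact: bM.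
- by move=> i; exact: (adjoint_exists A _ KA _ (bM i)).
- by move=> f; exact: deck_proj_carrier.
- by move=> c f g; exact: deck_proj_linear.
- by move=> f; exact: deck_proj_idempotent.
- by move=> f g; exact: deck_proj_selfadjoint.
- by move=> i f; exact: mult_blaschke_deck_proj.
Qed.
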